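(* Let $q$ be a power of a prime $p$, let $d\mid (q-1)$, let $\gamma$ be a primitive element of $\mathbb{F}_q$, let $C_0$ be the set of nonzero $d$-th powers in $\mathbb{F}_q$ and $C_i=\gamma^iC_0$ for $0\le i\le d-1$. Let $g(x)\in\mathbb{F}_q[x]$ be a polynomial such that $g(0)=0$ and $g(x)=a_iR_i(x)$ for $x\in C_i$, $0\le i\le d-1$, where $a_i\in\mathbb{F}_q$ and $R_i(x)\in\mathbb{F}_q[x]$ are nonzero polynomials with $R_i(0)=0$. Let $L=\{0\le i\le d-1\mid a_i\neq 0\}$ and $n_0=d-|L|$. Suppose the degree $r_i$ of $R_i$ satisfies $\gcd(r_i,p)=1$ for each $i\in L$, and let $r=\max\{r_i\mid i\in L\}$. Let $\psi:\mathbb{F}_q\to\mathbb{C}^*$ be a nontrivial additive character. Then $$\left|\sum_{x\in\mathbb{F}_q}\psi(g(x))-\frac{q}{d}n_0\right|\le (d-n_0)\,r\sqrt{q}.$$ Moreover, if $R_i(x)=x^{r_i}$ for all $0\le i\le d-1$, then $$\left|\sum_{x\in\mathbb{F}_q}\psi(g(x))-\frac{q}{d}n_0\right|\le (d-n_0)\max_{i\in L}\left\{\gcd\!\left(r_i,\frac{q-1}{d}\right)\right\}\sqrt{q}.$$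
   Context: The sets $C_0,\dots,C_{d-1}$ are the cyclotomic cosets of index $d$ in $\mathbb{F}_q^*$; they partition $\mathbb{F}_q^*$. *)

(* Defs.v *)
From HB Require Import structures.
From mathcomp Require Export all_boot all_order all_algebra.
From mathcomp Require Export complex reals.

Set Implicit Arguments.
Unset Strict Implicit.
Unset Printing Implicit Defensive.

Import Order.TTheory GRing.Theory Num.Theory.
Local Open Scope ring_scope.
Local Open Scope complex_scope.

Section Cyclotomic.
Variable F : finFieldType.

Definition nonzero_powers (d : nat) : {set F} :=
  [set y | (y != 0) && [exists x : F, y == x ^+ d]].

Definition cyclotomic_coset (d : nat) (gamma : F) (i : nat) : {set F} :=
  [set gamma ^+ i * y | y in nonzero_powers d].

End Cyclotomic.

(* The condition psi x != 0 says that psi takes its values in C^*. *)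
Definition additive_character (F : finFieldType) (R : realType)
    (psi : F -> R[i]) : Prop :=
  (forall x, psi x != 0) /\ (forall x y, psi (x + y) = psi x * psi y).

Definition nontrivial_character (F : finFieldType) (R : realType)
    (psi : F -> R[i]) : Prop :=
  exists x, psi x != 1.

(* Main.v *)
(* Substituting x = gamma^i y^d turns d times the sum over C_i into the sum of
   psi (h_i y) over nonzero y, with h_i = a_i R_i(gamma^i X^d) of degree d r_i
   prime to p; so everything follows from Weil's bound
   |sum_x psi (f x)| <= (n - 1) sqrt q for a polynomial f of degree n prime to p.
   (For monomials y^N may be replaced by y^(gcd(N, q - 1)).)

   No extension of F other than the residue fields F[X]/P is needed for Weil's
   bound.  For h monic let ptrace f h be the sum of f over the roots of h; then
   chi h = psi (ptrace f h) is multiplicative, and L(T) = sum over monic h of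
   chi h T^(deg h) is a polynomial of degree at most n - 1, because shifting the
   n-th coefficient of h from the top permutes the monic polynomials of a given
   degree m >= n and multiplies chi by a constant different from 1.  Comparing
   the logarithmic derivatives of the Euler product and of
   L(T) = prod (1 - w T), the power sums of the w are, up to sign, the sums S_k
   of deg P * chi (P^j) over irreducible P with j deg P = k.
   Stepanov's method (a polynomial of small degree divisible by every P with
   j deg P = 2t and ptrace f (P^j) = c) gives S_(2t) = O(q^t), hence
   |w| <= sqrt q for all w, and the sum in question is S_1. *)

From HB Require Import structures.
Require Import Defs.
From mathcomp Require Import all_boot all_order all_algebra.
From mathcomp Require Import complex reals.
From mathcomp Require Import finfield qfpoly zify ring.

Set Implicit Arguments.
Unset Strict Implicit.
Unset Printing Implicit Defensive.

Import Order.TTheory GRing.Theory Num.Theory.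
Local Open Scope ring_scope.
Local Open Scope complex_scope.

(** * The trace of a polynomial along a monic polynomial *)

Section TraceAlongPolynomial.

Variable F : fieldType.
Implicit Types f g h r : {poly F}.

(* The residue at infinity of f h'/h, so that it is the sum of f over the roots
   of a monic h with no reference to a splitting field. *)
Definition ptrace f h : F := ((f * h^`()) %% h)`_(size h).-2.

Lemma ptraceE f h q r :
  f * h^`() = q * h + r -> (size r < size h)%N -> ptrace f h = r`_(size h).-2.
Proof. by rewrite /ptrace => /modpP e /e <-. Qed.

(** Since [r] has no terms above degree [n], only its term of degree [n] times the leading term of
    [h] reaches this degree. *)
Lemma coefM_monic n h r :
  h \is monic -> (size r <= n.+1)%N -> (r * h)`_(n + (size h).-1) = r`_n.
Proof.
move=> h_mon; rewrite leq_eqVlt => /predU1P[r_n|r_lt].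
  have -> : (n + (size h).-1 = (size r + size h).-2)%N.
    rewrite r_n; have := monic_neq0 h_mon; rewrite -size_poly_gt0.
    by case: (size h) => // k _; rewrite addSn addnS.
  by rewrite -mul_lead_coef (monicP h_mon) mulr1 lead_coefE r_n.
rewrite [RHS]nth_default // nth_default //.
by rewrite (leq_trans (size_polyMleq _ _)) //; lia.
Qed.

Lemma ptrace1 f : ptrace f 1 = 0.
Proof. by rewrite /ptrace modp1 coef0. Qed.

(** The logarithmic derivative of a product is the sum of the logarithmic derivatives, so the
    residues at infinity add. *)
Lemma ptraceM f g h : g \is monic -> h \is monic ->
  ptrace f (g * h) = ptrace f g + ptrace f h.
Proof.
move=> g_mon h_mon.
(* The factor 1 is treated apart: its size is 1, where [.-2] truncates and the degree count below
   would be off by one. *)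
have [->|g_neq1] := eqVneq g 1; first by rewrite mul1r ptrace1 add0r.
have [->|h_neq1] := eqVneq h 1; first by rewrite mulr1 ptrace1 addr0.
have size_gt1 (k : {poly F}) : k \is monic -> k != 1 -> (1 < size k)%N.
  move=> k_mon; apply: contraR; rewrite -leqNgt => /size1_polyC k_const.
  by move: k_mon; rewrite k_const monicE lead_coefC => /eqP->.
have g_gt1 := size_gt1 _ g_mon g_neq1; have h_gt1 := size_gt1 _ h_mon h_neq1.
pose rg : {poly F} := (f * g^`()) %% g; pose rh : {poly F} := (f * h^`()) %% h.
have gr : (size rg < size g)%N by rewrite ltn_modp monic_neq0.
have hr : (size rh < size h)%N by rewrite ltn_modp monic_neq0.
have sizeE : size (g * h) = (size g + size h).-1.
  by rewrite size_monicM ?monic_neq0.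
rewrite (@ptraceE _ _ ((f * g^`()) %/ g + (f * h^`()) %/ h) (rg * h + rh * g)).
- rewrite coefD sizeE.
  rewrite [in X in X + _](_ : _.-2 = ((size g).-2 + (size h).-1)%N); last by lia.
  rewrite [in X in _ + X](_ : _.-2 = ((size h).-2 + (size g).-1)%N); last by lia.
  have rg_le : (size rg <= (size g).-2.+1)%N by lia.
  have rh_le : (size rh <= (size h).-2.+1)%N by lia.
  by rewrite !coefM_monic.
- have := divp_eq (f * g^`()) g; have := divp_eq (f * h^`()) h.
  rewrite -/rg -/rh derivM mulrDr mulrA [f * (g * _)]mulrCA => {1}-> {1}->.
  by rewrite !mulrDr !mulrDl; ring.
- rewrite sizeE (leq_ltn_trans (size_polyD _ _)) // gtn_max.
  by rewrite !(leq_ltn_trans (size_polyMleq _ _)) //; lia.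
Qed.

Lemma ptraceX f h j : h \is monic -> ptrace f (h ^+ j) = ptrace f h *+ j.
Proof.
move=> h_mon; elim: j => [|j IHj]; first by rewrite ptrace1.
by rewrite exprS mulrS ptraceM ?monic_exp // IHj.
Qed.

Lemma ptrace_XsubC f c : ptrace f ('X - c%:P) = f.[c].
Proof. by rewrite /ptrace derivXsubC mulr1 modp_XsubC size_XsubC coefC. Qed.

Lemma ptrace_prod_XsubC f (s : seq F) :
  ptrace f (\prod_(c <- s) ('X - c%:P)) = \sum_(c <- s) f.[c].
Proof.
elim: s => [|c s IHs]; first by rewrite !big_nil ptrace1.
by rewrite !big_cons ptraceM ?monicXsubC ?monic_prod_XsubC // ptrace_XsubC IHs.
Qed.

(* The n-th power sum of the roots of h changes by -n * a when a is added to
   the n-th coefficient of h from the top, and the lower power sums do not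
   change. *)
Lemma ptrace_shift f h a n m :
  size f = n.+1 -> (0 < n <= m)%N -> h \is monic -> size h = m.+1 ->
  ptrace f (h + a *: 'X^(m - n)) = ptrace f h - a * n%:R * lead_coef f.
Proof.
move=> f_size /andP[n_gt0 n_le] h_mon h_size.
pose K : {poly F} := (f * h^`()) %/ h; pose r : {poly F} := (f * h^`()) %% h.
have h'_size : (size h^`() <= m)%N.
  by rewrite -ltnS -h_size lt_size_deriv ?monic_neq0.
have fh : f * h^`() = K * h + r by apply: divp_eq.
have r_lt : (size r <= m)%N by rewrite -ltnS -h_size ltn_modp monic_neq0.
have h2_size : size (h + a *: 'X^(m - n)) = m.+1.
  rewrite size_polyDl h_size // (leq_ltn_trans (size_scale_leq _ _)) //.
  by rewrite size_polyXn; lia.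
rewrite {1}/ptrace h2_size /=.
have K_size : (size K <= n)%N.
  rewrite size_divp ?monic_neq0 // h_size leq_subLR.
  rewrite (leq_trans (size_polyMleq _ _)) // f_size addSn /=.
  by rewrite addnC leq_add2r.
(* Compare coefficients of degree n - 1 + m in f h' = K h + r, where [r] contributes nothing. *)
have K_top : K`_n.-1 = lead_coef f * m%:R.
  have := congr1 (fun p : {poly F} => p`_(n.-1 + m)) fh.
  have -> : (n.-1 + m = n.-1 + (size h).-1)%N by rewrite h_size.
  rewrite coefD (@coefM_monic _ h K) ?prednK // => /esym.
  rewrite [r`__]nth_default ?addr0; last first.
    by rewrite (leq_trans r_lt) // h_size; lia.
  move=> ->; rewrite lead_coefE f_size /= h_size /=.
  rewrite coefM (bigD1 (inord n)) //= inordK; last by lia.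
  rewrite big1 ?addr0 => [|i i_n].
    rewrite (_ : (_ + _ - n)%N = m.-1); last by lia.
    rewrite coef_deriv prednK; last by lia.
    have := monicP h_mon; rewrite lead_coefE h_size /= => ->.
    by [].
  have {i_n} i_n : (i : nat) != n.
    by apply: contra i_n => /eqP i_n; apply/eqP/val_inj; rewrite /= inordK; lia.
  have [n_lt|i_le] := ltnP n i.
    by rewrite [f`__]nth_default ?mul0r // f_size.
  by rewrite [_^`()`__]nth_default ?mulr0 // (leq_trans h'_size) //; lia.
(* The quotient [K] also serves for the shifted polynomial, with remainder [r2]. In degree m - 1 the
   two corrections add up to - a m + a (m - n) = - a n times the leading coefficient of [f]. *)
set r2 := r - a *: ('X^(m - n) * K) + (a * (m - n)%:R) *: ('X^((m - n).-1) * f).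
rewrite -[in RHS]/(_ %% _) -/r.
have <- : r2 = (f * (h + a *: 'X^(m - n))^`()) %% (h + a *: 'X^(m - n)).
  apply: (@modpP _ _ K).
    rewrite /r2 derivD derivZ derivXn mulrDr fh -!mul_polyC polyCM mulrDr.
    rewrite -[_ *+ (m - n)]mulr_natr polyC_natr; ring.
  rewrite h2_size ltnS /r2 (leq_trans (size_polyD _ _)) // geq_max.
  rewrite (leq_trans (size_polyD _ _)) ?geq_max ?r_lt ?size_polyN /=.
    (* For m = n the exponent [(m - n).-1] is truncated, but its term carries the factor m - n =
       0. *)
    have [mn0|mn_neq0] := eqVneq (m - n)%N 0%N.
      by rewrite mn0 mulr0 scale0r size_poly0.
    rewrite (leq_trans (size_scale_leq _ _)) // (leq_trans (size_polyMleq _ _)) //.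
    by rewrite size_polyXn f_size; lia.
  rewrite (leq_trans (size_scale_leq _ _)) // (leq_trans (size_polyMleq _ _)) //.
  by rewrite size_polyXn; lia.
rewrite /r2 !coefD coefN !coefZ !coefXnM ltnNge.
rewrite (_ : (_ <= _)%N = true) /=; last by lia.
rewrite (_ : (m.-1 - (m - n) = n.-1)%N) ?K_top; last by lia.
rewrite /ptrace h_size /= -/r -addrA; congr (_ + _).
have [mn0|mn_neq0] := eqVneq (m - n)%N 0%N.
  have -> : m = n by lia.
  by rewrite subnn mulr0 mul0r addr0 [lead_coef f * _]mulrC mulrA.
rewrite ltnNge (_ : (_ <= _)%N = true) /=; last by lia.
rewrite (_ : (m.-1 - (m - n).-1 = n)%N); last by lia.
have -> : f`_n = lead_coef f by rewrite lead_coefE f_size.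
by rewrite natrB //; ring.
Qed.

End TraceAlongPolynomial.

Lemma map_ptrace (F K : fieldType) (phi : {rmorphism F -> K}) (f h : {poly F}) :
  ptrace (map_poly phi f) (map_poly phi h) = phi (ptrace f h).
Proof. by rewrite /ptrace deriv_map -rmorphM -map_modp size_map_poly coef_map. Qed.

(** * Residue fields of irreducible polynomials *)

Lemma expr_sum_pchar (A : comNzRingType) (I : Type) (s : seq I) (C : pred I)
    (E : I -> A) n :
  [pchar A].-nat n -> (\sum_(i <- s | C i) E i) ^+ n = \sum_(i <- s | C i) E i ^+ n.
Proof.
move=> n_char; apply: (big_morph (fun x => x ^+ n)) => [x y|].
  exact: exprDn_pchar.
by rewrite expr0n; case: n n_char.
Qed.

Lemma pnat_pchar_card_expn (F : finFieldType) (A : nzRingType)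
    (phi : {rmorphism F -> A}) i :
  [pchar A].-nat (#|F| ^ i)%N.
Proof.
have [p p_prime p_char] := finPcharP F.
have p_charA : p \in [pchar A] by apply: rmorph_pchar p_char.
rewrite (eq_pnat _ (pcharf_eq p_charA)) pnatX; apply/orP; left.
have := abelian.abelem_pgroup (abelian.fin_ring_pchar_abelem p_char).
by rewrite /pgroup.pgroup cardsT.
Qed.

Lemma expf_card_expn (F : finFieldType) (x : F) i : x ^+ (#|F| ^ i) = x.
Proof. by elim: i => // i IHi; rewrite expnSr exprM IHi expf_card. Qed.

(** The quotient F[X]/P, presented by the kernel of the reduction map, its surjectivity and the
    order of the field, which is all that is used below. *)
Lemma residue_field (F : finFieldType) (P : {poly F}) :
  monic_irreducible_poly P ->
  exists (K : finFieldType) (phi : {rmorphism {poly F} -> K}),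
  [/\ forall g, (phi g == 0) = (P %| g), forall z, exists g, phi g = z
    & #|K| = (#|F| ^ (size P).-1)%N].
Proof.
move=> P_irr.
pose red : {poly F} -> {poly %/ P with P_irr} := in_qpoly P.
have redD : zmod_morphism red by move=> g h; rewrite /red raddfB.
have redM : monoid_morphism red by split=> [|g h]; rewrite /red ?rmorph1 ?rmorphM.
pose redA := GRing.isZmodMorphism.Build _ _ red redD.
pose redR := GRing.isMonoidMorphism.Build _ _ red redM.
pose phi : {rmorphism {poly F} -> {poly %/ P with P_irr}} :=
  HB.pack red redA redR.
exists {poly %/ P with P_irr}, phi; split=> [g|z|]; last exact: card_qfpoly.
- have -> : P %| g = (Pdiv.Ring.rmodp g (mk_monic P) == 0).
    by rewrite (mk_monicE P_irr) -Pdiv.IdomainMonic.modpE ?P_irr.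
  by apply/idP/idP => [/val_eqP|] // ?; apply/val_eqP.
- exists (val (z : {poly %/ P})); apply: val_inj.
  by apply: (@in_qpoly_small _ P); apply: size_mk_monic.
Qed.

(** * Conjugate roots and the trace from a residue field *)

Section ConjugateRoots.

Variables (F K : finFieldType) (P : {poly F}) (phi : {rmorphism {poly F} -> K}).
Hypothesis P_monic : P \is monic.
Hypothesis phi_eq0 : forall g, (phi g == 0) = (P %| g).
Hypothesis phi_surj : forall z, exists g, phi g = z.
Hypothesis card_K : #|K| = (#|F| ^ (size P).-1)%N.

Let q := #|F|.
Let e := (size P).-1.
Let inj : {rmorphism F -> K} := phi \o polyC.

Let q_gt1 : (1 < q)%N. Proof. exact: finNzRing_gt1. Qed.

(** Raising to the power q^i is additive and fixes the coefficients of [g], so it passes from the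
    value to the argument. *)
Let phi_horner g i : (map_poly inj g).[phi 'X ^+ (q ^ i)] = phi g ^+ (q ^ i).
Proof.
rewrite -[g in RHS]coefK poly_def horner_coef size_map_poly rmorph_sum.
rewrite expr_sum_pchar; last exact: pnat_pchar_card_expn inj _.
apply: eq_bigr => j _; rewrite coef_map /= -mul_polyC rmorphM rmorphXn.
by rewrite exprMn -!exprM mulnC -[in RHS]rmorphXn -polyC_exp expf_card_expn.
Qed.

Lemma conjugate_roots_prod :
  map_poly inj P = \prod_(i < e) ('X - (phi 'X ^+ (q ^ i))%:P).
Proof.
pose rs := [seq phi 'X ^+ (q ^ i) | i : 'I_e].
have e_size : size rs = e by rewrite size_map -cardE card_ord.
have rs_root : all (root (map_poly inj P)) rs.
  apply/allP => _ /mapP[i _ ->]; rewrite rootE phi_horner expf_eq0.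
  by rewrite phi_eq0 dvdpp expn_gt0 ltnW.
have rs_uniq : uniq rs.
  rewrite map_inj_uniq ?enum_uniq // => i j eq_ij; apply/val_inj/eqP => /=.
  wlog lt_ij : i j eq_ij / (i < j)%N => [wlog_ij|].
    by case: ltngtP => // lt_ij; [have := wlog_ij i j | have := wlog_ij j i];
      rewrite ?ltn_eqF // => ->; rewrite // gtn_eqF.
  (* If two conjugates agree, every element of [K], being some [phi g], is a root of [D]; but [D]
     has degree q^j < q^e = |K|. *)
  pose D : {poly K} := 'X^(q ^ j) - 'X^(q ^ i).
  have D_size : size D = (q ^ j).+1.
    by rewrite size_polyDl size_polyXn // size_polyN size_polyXn ltnS ltn_exp2l.
  have D_neq0 : D != 0 by rewrite -size_poly_gt0 D_size.
  have D_root : all (root D) (enum K).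
    apply/allP => z _; have [g <-] := phi_surj z.
    by rewrite rootE !hornerE -(phi_horner g i) -(phi_horner g j) eq_ij subrr.
  have := max_poly_roots D_neq0 D_root (enum_uniq K).
  by rewrite -cardE card_K D_size ltnS leq_exp2l // leqNgt ltn_ord.
have P_size : size (map_poly inj P) = (size rs).+1.
  by rewrite size_map_poly e_size prednK // size_poly_gt0 monic_neq0.
rewrite (all_roots_prod_XsubC P_size rs_root) ?uniq_rootsE //.
by rewrite (monicP _) ?map_monic // scale1r big_map big_enum.
Qed.

Lemma ptrace_conjugates f : inj (ptrace f P) = \sum_(i < e) phi f ^+ (q ^ i).
Proof.
rewrite -map_ptrace conjugate_roots_prod -big_enum /=.
rewrite -(big_map (fun i : 'I_e => phi 'X ^+ (q ^ i)) xpredT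
  (fun z => 'X - z%:P)) ptrace_prod_XsubC big_map big_enum.
by apply: eq_bigr => i _; rewrite phi_horner.
Qed.

(** The q^e-th power is the identity on [K], so j copies of the trace line up into one sum of j e
    consecutive Frobenius powers. For j e = 2t it can then be cut in the middle. *)
Lemma ptraceX_conjugates f j :
  inj (ptrace f (P ^+ j)) = \sum_(0 <= i < j * e) phi f ^+ (q ^ i).
Proof.
have -> : inj (ptrace f (P ^+ j)) = inj (ptrace f P) *+ j.
  by rewrite ptraceX // rmorphMn.
rewrite ptrace_conjugates.
elim: j => [|j IHj]; first by rewrite big_geq.
rewrite mulSn (big_cat_nat _ (n := e)) ?leq_addr //= mulrS big_mkord; congr (_ + _).
rewrite IHj -[X in _ = \sum_(X <= i < _) _]add0n big_addn addKn.
by apply: eq_bigr => i _; rewrite addnC expnD exprM -card_K expf_card.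
Qed.

End ConjugateRoots.

(** * Stepanov's auxiliary polynomial *)

Section FamiliesOfPolynomials.

Variables (F : finFieldType) (I : finType) (phi : I -> {poly F}).

(** Pigeonhole: there are more coefficient vectors than polynomials of size at most [D], so two
    combinations coincide. *)
Lemma small_family_dependent D :
  (forall i, size (phi i) <= D)%N -> (D < #|I|)%N ->
  exists2 c : I -> F, exists i, c i != 0 & \sum_i c i *: phi i = 0.
Proof.
move=> phi_size D_lt.
pose comb (c : {ffun I -> F}) := \sum_i c i *: phi i.
have comb_size c : (size (comb c) <= D)%N.
  rewrite (leq_trans (size_sum _ _ _)) //; apply/bigmax_leqP => i _.
  by rewrite (leq_trans (size_scale_leq _ _)).
have /injectivePn[c1 [c2 neq_c eq_comb]] :
    ~~ injectiveb (fun c => npolyp D (comb c)).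
  apply: contraL D_lt => /injectiveP/leq_card.
  by rewrite card_npoly card_ffun leq_exp2l ?finNzRing_gt1 // -leqNgt.
exists (fun i => c1 i - c2 i).
  apply/existsP; apply: contraR neq_c; rewrite negb_exists => /forallP c_eq.
  by apply/eqP/ffunP => i; apply/eqP; have := c_eq i; rewrite negbK subr_eq0.
have {}eq_comb : comb c1 = comb c2.
  by have /(congr1 val) := eq_comb; rewrite /= !npolypK.
under eq_bigr do rewrite scalerBl.
by rewrite sumrB -/(comb c1) eq_comb subrr.
Qed.

(** Among the indices with nonzero coefficient, the one of largest size has a leading term that
    nothing can cancel. *)
Lemma distinct_size_independent (c : I -> F) :
  (forall i, phi i != 0) -> injective (fun i => size (phi i)) ->
  \sum_i c i *: phi i = 0 -> forall i, c i = 0.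
Proof.
move=> phi_neq0 size_inj comb0 i1; apply/eqP/negPn/negP => ci1_neq0.
case: (@arg_maxnP I i1 (fun i => c i != 0) (fun i => size (phi i)) ci1_neq0) => i ci_neq0 i_max.
have /(congr1 (fun p : {poly F} => p`_(size (phi i)).-1)) := comb0.
rewrite coef0 coef_sum (bigD1 i) //= coefZ -lead_coefE big1 ?addr0.
  by apply/eqP; rewrite mulf_neq0 ?lead_coef_eq0.
move=> j j_neq_i; have [->|cj_neq0] := eqVneq (c j) 0; first by rewrite scale0r coef0.
rewrite coefZ nth_default ?mulr0 // -ltnS prednK ?size_poly_gt0 //.
rewrite ltn_neqAle (i_max j cj_neq0 : (_ <= _)%N) andbT.
by apply: contra j_neq_i => /eqP/size_inj->.
Qed.

End FamiliesOfPolynomials.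

Section Stepanov.

Variables (F : finFieldType) (f : {poly F}) (n t : nat).
Let q := #|F|.
Hypothesis f_size : size f = n.+1.
Hypothesis n_gt0 : (0 < n)%N.
Hypothesis n_coprime : coprime n q.
Hypothesis t_gt0 : (0 < t)%N.

Let M := (q ^ t.-1)%N.
Let T := (q ^ t)%N.
Let q_gt1 : (1 < q)%N. Proof. exact: finNzRing_gt1. Qed.
Let M_gt0 : (0 < M)%N. Proof. by rewrite expn_gt0 ltnW. Qed.
Let T_def : T = (q * M)%N. Proof. by rewrite /T /M -expnS prednK. Qed.

(** Half of the sum of 2t conjugates: modulo [P] with j deg P = 2t, [half_trace] plus its [T]-th
    power is [ptrace f (P ^+ j)]. *)
Let half_trace := \sum_(i < t) f ^+ (q ^ i).

Lemma size_half_trace : size half_trace = (n * M).+1.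
Proof.
rewrite /half_trace /M; case: (t) t_gt0 => //= s _; elim: s => [|s IHs]; first by rewrite big_ord1 expr1 f_size muln1.
have f_expn k : size (f ^+ k) = (n * k).+1.
  have := size_exp f k; rewrite f_size /= => <-; rewrite prednK //.
  by rewrite size_poly_gt0 expf_neq0 // -size_poly_gt0 f_size.
rewrite big_ord_recr /= addrC size_polyDl f_expn // IHs.
by rewrite ltnS ltn_pmul2l // ltn_exp2l.
Qed.

(** Exponents of X, of X^T and of [half_trace]. The range M + n is chosen so that the number q M (M
    + n) of exponents exceeds the size bound of [twist], namely by (q - 1) M + n (M - 1). *)
Let I := ('I_M * 'I_(M + n) * 'I_q)%type.
Let mono (i : I) : {poly F} :=
  'X^(i.1.1) * 'X^(T * i.1.2) * half_trace ^+ i.2.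

Let size_mono i : size (mono i) = (i.1.1 + T * i.1.2 + n * M * i.2).+1.
Proof.
have ht_neq0 : half_trace != 0 by rewrite -size_poly_gt0 size_half_trace.
rewrite /mono -exprD size_monicM ?monicXn ?expf_neq0 // size_polyXn addSn /=.
have := size_exp half_trace i.2; rewrite size_half_trace /= => <-.
by rewrite -addnS prednK // size_poly_gt0 expf_neq0.
Qed.

(** The degree is (q a' + n b) M + a: its residue modulo [M] gives a, and then the residue of q a' +
    n b modulo q gives b because n is prime to q. *)
Let size_mono_inj : injective (fun i => size (mono i)).
Proof.
move=> [[a1 a1'] b1] [[a2 a2'] b2]; rewrite !size_mono /= T_def => -[eq_ab].
have decomp (a a' b : nat) :
    (a + q * M * a' + n * M * b = (q * a' + n * b) * M + a)%N by ring.
rewrite !decomp in eq_ab.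
have eq_a : a1 = a2.
  apply/val_inj; have := congr1 (modn^~ M) eq_ab.
  by rewrite !modnMDl !modn_small.
move: eq_ab; rewrite eq_a => /addIn/eqP; rewrite eqn_pmul2r // => /eqP eq_ab.
have eq_b : b1 = b2.
  have q_dvd (k1 k2 l1 l2 : nat) : (q * k1 + n * l1 = q * k2 + n * l2)%N ->
      (l2 < q)%N -> (l1 <= l2)%N -> l1 = l2.
    move=> eq_kl l2_lt le_l; apply/eqP; rewrite eqn_leq le_l -subn_eq0 /=.
    have : (q %| n * (l2 - l1))%N.
      rewrite mulnBr; have -> : (n * l2 - n * l1 = q * k1 - q * k2)%N by lia.
      by rewrite -mulnBr dvdn_mulr.
    rewrite Gauss_dvdr 1?coprime_sym //; apply: contraTT; rewrite -lt0n => l_gt0.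
    by rewrite gtnNdvd // (leq_ltn_trans (leq_subr _ _)).
  apply/val_inj; have [le_b|/ltnW le_b] := leqP b1 b2.
    exact: q_dvd eq_ab (ltn_ord _) le_b.
  exact/esym/(q_dvd _ _ _ _ (esym eq_ab) (ltn_ord _) le_b).
move: eq_ab; rewrite eq_b => /addIn/eqP; rewrite eqn_pmul2l 1?ltnW // => /eqP.
by move/val_inj ->.
Qed.

(* If G is the combination of the [mono i] with coefficients c i, then G ^+ T
   is congruent to the combination of the [twist i] modulo every P considered
   below, because T-th powers are additive, X ^+ (q ^ 2t) = X and
   half_trace ^+ T = c - half_trace there. *)
Let twist (c : F) (i : I) : {poly F} :=
  'X^(T * i.1.1) * 'X^(i.1.2) * (c%:P - half_trace) ^+ i.2.

Let size_twist c i :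
  (size (twist c i) <= T * M.-1 + (M + n) + n * M * q.-1)%N.
Proof.
have a_le : (i.1.1 <= M.-1)%N by rewrite -ltnS prednK.
have b_le : (i.2 <= q.-1)%N by rewrite -ltnS prednK // ltnW.
have a'_le := ltn_ord i.1.2.
have base_size : (size (c%:P - half_trace)%R <= (n * M).+1)%N.
  rewrite (leq_trans (size_polyD _ _)) // geq_max size_polyN size_half_trace.
  by rewrite leqnn andbT (leq_trans (size_polyC_leq1 _)).
have exp_size : (size ((c%:P - half_trace) ^+ i.2)%R <= (n * M * i.2).+1)%N.
  by rewrite (leq_trans (size_poly_exp_leq _ _)) // ltnS leq_mul2r; lia.
rewrite /twist -exprD (leq_trans (size_polyMleq _ _)) // size_polyXn addSn /=.
rewrite (leq_trans (leq_add (leqnn _) exp_size)) //.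
have := leq_mul (leqnn T) a_le; have := leq_mul (leqnn (n * M)) b_le; lia.
Qed.

(** The twists are too many to be independent. The coefficients of a relation between them define G
    from the [mono i], which is nonzero since these have distinct degrees, while its [T]-th power
    vanishes modulo [P]. *)
Lemma stepanov_polynomial (c : F) :
  exists G : {poly F},
  [/\ G != 0, (size G <= (q ^ t.*2.-1 + 2 * n * T).+1)%N
    & forall P j, monic_irreducible_poly P -> (j * (size P).-1)%N = t.*2 ->
      ptrace f (P ^+ j) = c -> P %| G].
Proof.
have card_I : (T * M.-1 + (M + n) + n * M * q.-1 < #|{: I}|)%N.
  rewrite !card_prod !card_ord T_def.
  move: M_gt0 q_gt1; clear; case: (M) => // k _; case: (q) => [|[|l]] // _ /=; nia.
have [d [i0 d_neq0] twist0] := small_family_dependent (size_twist c) card_I.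
exists (\sum_i d i *: mono i); split.
- apply: contra d_neq0 => /eqP/distinct_size_independent-> // i.
  by rewrite -size_poly_gt0 size_mono.
- rewrite (leq_trans (size_sum _ _ _)) //; apply/bigmax_leqP => i _.
  rewrite (leq_trans (size_scale_leq _ _)) // size_mono ltnS.
  have -> : (q ^ t.*2.-1 = T * M)%N.
    by rewrite /T /M -expnD; congr (_ ^ _)%N; move: t_gt0; clear; lia.
  have := ltn_ord i.1.1; have := ltn_ord i.1.2; have := ltn_ord i.2.
  move: (nat_of_ord i.1.1) (nat_of_ord i.1.2) (nat_of_ord i.2) => x y z.
  rewrite T_def; move: M_gt0 q_gt1; clear.
  case: (M) => // k _; case: (q) => [|[|l]] // _ z_le y_le x_le.
  have yz : (l.+2 * k.+1 * y <= l.+2 * k.+1 * (k + n))%N by rewrite leq_mul2l; lia.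
  have zz : (n * k.+1 * z <= n * k.+1 * l.+1)%N by rewrite leq_mul2l; lia.
  by nia.
move=> P j P_irr P_deg P_trace.
have [K [phi [phi_eq0 phi_surj card_K]]] := residue_field P_irr.
have P_monic := P_irr.2.
pose inj : {rmorphism F -> K} := phi \o polyC.
have T_char : [pchar K].-nat T by apply: pnat_pchar_card_expn inj _.
have phi_expn z : z ^+ (q ^ t.*2) = z :> K.
  by rewrite -P_deg mulnC expnM -card_K expf_card_expn.
have phi_half : phi half_trace ^+ T = phi (c%:P - half_trace).
  have phi_ht : phi half_trace = \sum_(i < t) phi f ^+ (q ^ i).
    by rewrite rmorph_sum; apply: eq_bigr => i _; rewrite rmorphXn.
  rewrite rmorphB /= -[phi c%:P]/(inj c) -P_trace.
  rewrite (ptraceX_conjugates P_monic phi_eq0 phi_surj card_K) P_deg -addnn.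
  rewrite (big_cat_nat _ (n := t)) ?leq_addr //= big_mkord phi_ht addrAC subrr.
  rewrite add0r expr_sum_pchar // -[X in _ = \sum_(X <= i < _) _]add0n big_addn.
  rewrite addnK big_mkord; apply: eq_bigr => i _.
  by rewrite -exprM -expnD.
have phi_expT : phi (\sum_i d i *: mono i) ^+ T = 0.
  transitivity (phi (\sum_i d i *: twist c i)); last by rewrite twist0 rmorph0.
  rewrite !rmorph_sum expr_sum_pchar //=.
  apply: eq_bigr => i _; rewrite /mono /twist -!mul_polyC !rmorphM !exprMn.
  congr (_ * (_ * _ * _)).
  - by rewrite -rmorphXn -polyC_exp expf_card_expn.
  - by rewrite !rmorphXn -exprM mulnC.
  - rewrite !rmorphXn -exprM; have -> : (T * i.1.2 * T = q ^ t.*2 * i.1.2)%N.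
      by rewrite -addnn expnD -/T mulnAC.
    by rewrite exprM phi_expn.
  - by rewrite !rmorphXn -exprM mulnC exprM phi_half.
rewrite -phi_eq0; move/eqP: phi_expT; rewrite expf_eq0 => /andP[_].
by [].
Qed.

End Stepanov.

(** * Monic polynomials and the Euler product *)

Section MonicPolynomials.

Variable F : finFieldType.
Implicit Types (P g h : {poly F}) (m N : nat).

Definition bounded_polys N : seq {poly F} := [seq val p | p : {poly_N F}].

Lemma mem_bounded_polys N p : (p \in bounded_polys N) = (size p <= N)%N.
Proof.
apply/imageP/idP => [[r _ ->]|p_size]; first exact: size_npoly.
by exists (npolyp N p); rewrite //= npolypK.
Qed.

Lemma uniq_bounded_polys N : uniq (bounded_polys N).
Proof. by rewrite map_inj_uniq ?enum_uniq //; apply: val_inj. Qed.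

Definition monics m : seq {poly F} := [seq 'X^m + p | p <- bounded_polys m].

Lemma mem_monics m h : (h \in monics m) = (h \is monic) && (size h == m.+1).
Proof.
apply/mapP/andP => [[p]|[h_mon /eqP h_size]].
  rewrite mem_bounded_polys => p_size ->.
  have p_lt : (size p < size ('X^m : {poly F})%R)%N by rewrite size_polyXn.
  by rewrite monicE lead_coefDl // lead_coefXn size_polyDl // size_polyXn.
exists (h - 'X^m); last by rewrite addrC subrK.
rewrite mem_bounded_polys; apply/leq_sizeP => j; rewrite coefB coefXn.
rewrite leq_eqVlt => /predU1P[<-|m_lt].
  by rewrite eqxx; have := monicP h_mon; rewrite lead_coefE h_size => ->; rewrite subrr.
by rewrite gtn_eqF // nth_default ?subrr // h_size.
Qed.

Lemma uniq_monics m : uniq (monics m).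
Proof. by rewrite map_inj_uniq ?uniq_bounded_polys //; apply: addrI. Qed.

Lemma size_monics m : size (monics m) = (#|F| ^ m)%N.
Proof. by rewrite size_map size_image card_npoly. Qed.

Lemma monics0 : monics 0 = [:: 1].
Proof.
apply: perm_small_eq => //; apply: uniq_perm; rewrite ?uniq_monics // => h.
rewrite mem_monics inE; apply/andP/eqP => [[h_mon /eqP h_size]|->].
  have hC : h = (h`_0)%:P by apply: size1_polyC; rewrite h_size.
  by move: h_mon; rewrite hC monicE lead_coefC => /eqP->.
by rewrite monic1 size_poly1.
Qed.

Lemma monics1 : perm_eq (monics 1) [seq 'X - x%:P | x : F].
Proof.
apply: uniq_perm => [||h]; first exact: uniq_monics.
  by rewrite map_inj_uniq ?enum_uniq // => x y /addrI/oppr_inj/polyC_inj.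
rewrite mem_monics; apply/andP/imageP => [[h_mon /eqP h_size]|[x _ ->]].
  exists (- h`_0) => //; apply/polyP => -[|[|i]]; rewrite coefB coefX coefC /=.
  - by rewrite sub0r opprK.
  - by rewrite subr0; have := monicP h_mon; rewrite lead_coefE h_size.
  - by rewrite subr0 nth_default // h_size.
by rewrite monicXsubC size_XsubC.
Qed.

Lemma big_monics_dvdp (A : nmodType) (phi : {poly F} -> A) D e m :
  D \is monic -> size D = e.+1 ->
  \sum_(h <- monics m | D %| h) phi h =
  if (e <= m)%N then \sum_(g <- monics (m - e)) phi (D * g) else 0.
Proof.
move=> D_mon D_size; have D_neq0 := monic_neq0 D_mon.
case: leqP => [e_le|m_lt]; last first.
  rewrite big_seq_cond big1 // => h; rewrite mem_monics => /andP[/andP[h_mon]].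
  move=> /eqP h_size /dvdp_leq; rewrite D_size h_size => /(_ (monic_neq0 h_mon)).
  by rewrite ltnS leqNgt m_lt.
rewrite -(big_map (fun g => D * g) xpredT phi).
rewrite -[LHS]big_filter; apply: perm_big.
apply: uniq_perm => [||h]; first by rewrite filter_uniq ?uniq_monics.
  by rewrite map_inj_uniq ?uniq_monics //; apply: mulfI.
rewrite mem_filter; apply/andP/mapP => [[/dvdpP[g ->]]|[g]].
  rewrite mem_monics monicMr // => /andP[g_mon].
  rewrite size_monicM ?monic_neq0 // D_size addnS => /eqP h_size.
  exists g; last by rewrite mulrC.
  by rewrite mem_monics g_mon /=; apply/eqP; move: h_size e_le => /= ; lia.
rewrite mem_monics => /andP[g_mon /eqP g_size] ->; rewrite dvdp_mulr //.
rewrite mem_monics monicMl // g_mon size_monicM ?monic_neq0 // D_size g_size.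
by split=> //=; apply/eqP; lia.
Qed.

Definition irrs N : seq {poly F} :=
  [seq P <- bounded_polys N.+1 | (P \is monic) && irreducibleb P].

Lemma mem_irrs N P :
  reflect (monic_irreducible_poly P /\ (size P <= N.+1)%N) (P \in irrs N).
Proof.
rewrite mem_filter mem_bounded_polys; apply: (iffP andP) => [[/andP[P_mon]]|].
  by move=> /irreducibleP P_irr P_size; split; first by split.
by move=> [[/irreducibleP -> ->] ->].
Qed.

Lemma uniq_irrs N : uniq (irrs N).
Proof. by rewrite filter_uniq ?uniq_bounded_polys. Qed.

Lemma coprimep_irr P Q :
  monic_irreducible_poly P -> monic_irreducible_poly Q -> P != Q -> coprimep P Q.
Proof.
move=> [P_irr P_mon] [Q_irr Q_mon] neq_PQ; rewrite irreducible_poly_coprime //.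
apply: contra neq_PQ => PQ; rewrite -eqp_monic //.
by apply: Q_irr.2 PQ; case: P_irr => P_gt1 _; rewrite gtn_eqF.
Qed.

Lemma irr_factor h : h \is monic -> (1 < size h)%N ->
  exists2 P, monic_irreducible_poly P & P %| h.
Proof.
have [s] := ubnP (size h); elim: s h => // s IHs h h_lt h_mon h_gt1.
have [h_irr|] := boolP (irreducibleb h).
  by exists h => //; split => //; apply/irreducibleP.
rewrite /irreducibleb h_gt1 /= negb_forall => /existsP[g].
rewrite negb_imply -ltnNge -Pdiv.Idomain.dvdpE => /andP[g_dvd g_gt1].
have g_neq0 : (val g : {poly F}) != 0 by rewrite -size_poly_gt0 ltnW.
have lc_neq0 : (lead_coef (val g))^-1 != 0 by rewrite invr_eq0 lead_coef_eq0.
have g_lt : (size (val g : {poly F}) < size h)%N.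
  by rewrite (leq_ltn_trans (size_npoly g)) // ltn_predL ltnW.
have [||| P P_irr] := IHs ((lead_coef (val g))^-1 *: val g).
- by rewrite size_scale // (leq_trans g_lt).
- by rewrite monicE lead_coefZ mulVf // lead_coef_eq0.
- by rewrite size_scale.
by rewrite dvdpZr // => P_dvd; exists P => //; apply: dvdp_trans g_dvd.
Qed.

(** The number of j >= 1 with P^j dividing [h] is the multiplicity of [P]. Splitting off one
    irreducible factor Q raises this number by one for Q and leaves the others unchanged. *)
Lemma degree_irr_sum N h : h \is monic -> (size h <= N.+1)%N ->
  (\sum_(P <- irrs N) \sum_(1 <= j < N.+1 | (P ^+ j %| h)%R) (size P).-1)%N = (size h).-1.
Proof.
have [s] := ubnP (size h); elim: s h => // s IHs h h_lt h_mon h_size.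
have expn_size P j : P \is monic -> size (P ^+ j) = ((size P).-1 * j).+1.
  by move=> P_mon; rewrite -size_exp prednK // size_poly_gt0 monic_neq0 ?monic_exp.
have [h_gt1|h_le1] := ltnP 1 (size h); last first.
  have -> : (size h).-1 = 0%N by lia.
  rewrite big_seq big1 // => P /mem_irrs[[[P_gt1 _] P_mon] _].
  rewrite big_nat_cond big1 // => j /andP[/andP[j_gt0 _]].
  move=> /(dvdp_leq (monic_neq0 h_mon)); rewrite expn_size // => /leq_trans.
  by move=> /(_ _ h_le1); rewrite ltnS leqn0 muln_eq0 (gtn_eqF j_gt0) orbF => /eqP.
have [Q Q_irr Q_dvd] := irr_factor h_mon h_gt1.
have [[Q_gt1 _] Q_mon] := Q_irr.
have [g h_def] : exists g : {poly F}, h = Q * g.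
  by have [g ->] := dvdpP _ _ Q_dvd; exists g; rewrite mulrC.
have g_mon : g \is monic by rewrite -(monicMr g Q_mon) mulrC -h_def.
have h_sizeE : size h = ((size Q).-1 + size g)%N.
  by rewrite h_def size_monicM ?monic_neq0 //; case: (size Q) Q_gt1.
have g_size : (0 < size g)%N by rewrite size_poly_gt0 monic_neq0.
have -> : (size h).-1 = ((size Q).-1 + (size g).-1)%N by rewrite h_sizeE; lia.
have g_le : (size g <= N)%N by rewrite -ltnS (leq_trans _ h_size) // h_sizeE; lia.
rewrite -(IHs g) //; [|by rewrite h_sizeE in h_lt; lia|exact: leqW].
have Q_in : Q \in irrs N.
  have Q_size : (size Q <= N.+1)%N by lia.
  exact/mem_irrs.
rewrite !(bigD1_seq Q) ?uniq_irrs //= addnA; congr (_ + _)%N; last first.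
  rewrite big_seq_cond [RHS]big_seq_cond; apply: eq_bigr => P.
  move=> /andP[/mem_irrs[P_irr _] neq_PQ]; apply: eq_bigl => j.
  by rewrite h_def Gauss_dvdpr // coprimep_expl // coprimep_irr.
have N_gt0 : (0 < N)%N by apply: leq_trans g_le.
(* Q^(j+1) divides Q g exactly when Q^j divides g, so the index shifts by one; the extra index N on
   the side of [g] contributes nothing, as Q^N is too large to divide [g]. *)
rewrite big_add1 /= big_ltn_cond // expr1 Q_dvd; congr (_ + _)%N.
rewrite [RHS]big_mkcond big_nat_recr //= [X in (_ + X)%N](_ : _ = 0%N).
  rewrite addn0 -big_mkcond /=; apply: eq_bigl => j.
  by rewrite h_def exprS dvdp_mul2l // monic_neq0.
case: ifP => // /(dvdp_leq (monic_neq0 g_mon)).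
by rewrite expn_size // ltnNge (leq_trans g_le) // leq_pmull // ltn_predRL.
Qed.

End MonicPolynomials.

(** * The logarithmic derivative of the Euler product *)

Section LogarithmicDerivative.

Variables (F : finFieldType) (A : comNzRingType) (chi : {poly F} -> A).
Hypothesis chiM : forall g h, g \is monic -> h \is monic ->
  chi (g * h) = chi g * chi h.

Definition coef_L m := \sum_(h <- monics F m) chi h.

(** The coefficient of T^k in T L'/L as read off from the Euler product. For k <= N the bound [N]
    leaves out no pair P, j with j deg P = k. *)
Definition irr_power_sum N k :=
  \sum_(P <- irrs F N) \sum_(1 <= j < N.+1 | (j * (size P).-1)%N == k)
    (size P).-1%:R * chi (P ^+ j).

(** Coefficients of T L' = (T L'/L) L. Write m = deg h as a sum over the prime powers P^j dividing
    h, exchange the sums and put h = P^j g. *)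
Lemma coef_L_rec N m : (m <= N)%N ->
  m%:R * coef_L m = \sum_(1 <= k < m.+1) irr_power_sum N k * coef_L (m - k).
Proof.
move=> m_le.
transitivity (\sum_(P <- irrs F N) \sum_(1 <= j < N.+1)
  if (j * (size P).-1 <= m)%N then
    (size P).-1%:R * chi (P ^+ j) * coef_L (m - j * (size P).-1) else 0).
  transitivity (\sum_(h <- monics F m) \sum_(P <- irrs F N)
      \sum_(1 <= j < N.+1 | P ^+ j %| h) (size P).-1%:R * chi h).
    rewrite /coef_L mulr_sumr big_seq [RHS]big_seq; apply: eq_bigr => h.
    rewrite mem_monics => /andP[h_mon /eqP h_size].
    have h_le : (size h <= N.+1)%N by rewrite h_size.
    have := degree_irr_sum h_mon h_le; rewrite h_size /= => <-.
    rewrite natr_sum mulr_suml; apply: eq_bigr => P _.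
    by rewrite natr_sum mulr_suml.
  rewrite exchange_big /= big_seq [RHS]big_seq; apply: eq_bigr => P.
  move=> /mem_irrs[[[P_gt1 _] P_mon] _].
  under eq_bigr do rewrite big_mkcond.
  rewrite exchange_big /=; apply: eq_bigr => j _; rewrite -big_mkcond /=.
  have PX_size : size (P ^+ j) = (j * (size P).-1).+1.
    by rewrite mulnC -size_exp prednK // size_poly_gt0 monic_neq0 ?monic_exp.
  rewrite (big_monics_dvdp _ _ (monic_exp _ P_mon) PX_size); case: ifP => // _.
  rewrite /coef_L mulr_sumr big_seq [RHS]big_seq; apply: eq_bigr => g.
  by rewrite mem_monics => /andP[g_mon _]; rewrite chiM ?monic_exp // mulrA.
under [RHS]eq_bigr do rewrite mulr_suml.
rewrite [RHS]exchange_big /= big_seq [RHS]big_seq; apply: eq_bigr => P.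
move=> /mem_irrs[[[P_gt1 _] P_mon] _].
under [RHS]eq_bigr do rewrite big_mkcond mulr_suml.
rewrite [RHS]exchange_big /= big_nat [RHS]big_nat; apply: eq_bigr => j /andP[j_gt0 _].
have jP_gt0 : (0 < j * (size P).-1)%N by rewrite muln_gt0 j_gt0 ltn_predRL.
case: leqP => [jP_le|m_lt].
  rewrite (bigD1_seq (j * (size P).-1)%N) ?iota_uniq //= ?eqxx; last first.
    by rewrite mem_index_iota jP_gt0 ltnS.
  by rewrite big1 ?addr0 // => k /negPf; rewrite eq_sym => ->; rewrite mul0r.
rewrite big_nat big1 // => k /andP[_ k_le]; case: eqP => [k_def|_]; last exact: mul0r.
by rewrite -k_def ltnS leqNgt m_lt in k_le.
Qed.

End LogarithmicDerivative.

(** * Power sums *)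

Section PowerSums.

Lemma coef_mul_1subX (A : comNzRingType) (w : A) (p : {poly A}) m :
  ((1 - w *: 'X) * p)`_m = p`_m - (if m is k.+1 then w * p`_k else 0).
Proof.
by rewrite mulrBl mul1r -scalerAl coefB coefZ coefXM; case: m => //; rewrite mulr0.
Qed.

(** Multiplication by the geometric series of w X inverts multiplication by 1 - w X. *)
Lemma sum_expr_coef_mul_1subX (A : comNzRingType) (w : A) (p : {poly A}) m :
  \sum_(0 <= k < m.+1) w ^+ k * ((1 - w *: 'X) * p)`_(m - k) = p`_m.
Proof.
elim: m => [|m IHm].
  by rewrite big_nat1 mul1r coef_mul_1subX subr0.
rewrite big_nat_recl // subn0 mul1r coef_mul_1subX.
under eq_bigr do rewrite exprS -mulrA subSS.
by rewrite -mulr_sumr IHm subrK.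
Qed.

(** Newton's identities, that is, X L' = - L times the sum of w X / (1 - w X), proved by adding one
    factor at a time. *)
Lemma newton_prod (A : comNzRingType) (ws : seq A) m :
  let L := \prod_(w <- ws) (1 - w *: 'X) in
  m%:R * L`_m = - \sum_(1 <= k < m.+1) (\sum_(w <- ws) w ^+ k) * L`_(m - k).
Proof.
elim: ws m => [|w ws IHws] m /=.
  rewrite big_nil coef1; under eq_bigr do rewrite big_nil mul0r.
  by rewrite big1_eq oppr0; case: m => [|m]; rewrite ?mul0r // mulr0.
rewrite big_cons; set L := \prod_(w <- ws) _ in IHws *.
case: m => [|m]; first by rewrite big_geq // mul0r oppr0.
under [in RHS]eq_bigr do rewrite big_cons mulrDl.
rewrite big_split /=.
rewrite [X in - (X + _)](_ : _ = w * L`_m); last first.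
  rewrite -(sum_expr_coef_mul_1subX w L m) mulr_sumr big_add1 /=.
  by apply: eq_bigr => k _; rewrite subSS exprS mulrA.
rewrite coef_mul_1subX mulrBr IHws.
under [in RHS]eq_big_nat => k k_le do rewrite coef_mul_1subX mulrBr.
rewrite sumrB [X in - (_ + (_ - X))](_ : _ = - (m%:R * (w * L`_m))).
  by rewrite -[m.+1]addn1 natrD; ring.
rewrite big_nat_recr //= subnn mulr0 addr0 mulrCA IHws mulrN opprK mulr_sumr.
rewrite big_nat [RHS]big_nat; apply: eq_bigr => k /andP[_ k_le].
by rewrite subSn // mulrCA.
Qed.

(** The system is triangular with diagonal entry [L 0] = 1. This serves to identify the power sums
    of the Euler product with those of a factorization. *)
Lemma power_sums_determined (A : comNzRingType) (L s p : nat -> A) N :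
  L 0%N = 1 ->
  (forall m, (m <= N)%N ->
    \sum_(1 <= k < m.+1) s k * L (m - k)%N = \sum_(1 <= k < m.+1) p k * L (m - k)%N) ->
  forall k, (0 < k <= N)%N -> s k = p k.
Proof.
move=> L0 eq_sp k; have [b] := ubnP k; elim: b k => // b IHb k k_lt.
move=> /andP[k_gt0 k_le]; have := eq_sp k k_le.
rewrite !big_nat_recr //= subnn L0 !mulr1.
have -> : \sum_(1 <= i < k) s i * L (k - i)%N = \sum_(1 <= i < k) p i * L (k - i)%N.
  rewrite big_nat [RHS]big_nat; apply: eq_bigr => i /andP[i_gt0 i_lt].
  by rewrite IHb ?i_gt0 /= ?(leq_trans i_lt) // ltnW // (leq_trans i_lt).
by move/addrI.
Qed.

(** The constant term 1 excludes the root 0, so the w are the inverses of the roots. *)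
Lemma prod_1subX_factor (C : closedFieldType) (L : {poly C}) :
  L`_0 = 1 -> exists2 ws : seq C, L = \prod_(w <- ws) (1 - w *: 'X)
    & size ws = (size L).-1.
Proof.
move=> L0; have [rs L_def] := closed_field_poly_normal L.
have L_neq0 : L != 0 by apply: contra_eq_neq L0 => ->; rewrite coef0 eq_sym oner_eq0.
have lc_neq0 : lead_coef L != 0 by rewrite lead_coef_eq0.
have L0_prod : lead_coef L * \prod_(z <- rs) (- z) = 1.
  transitivity (L`_0) => //; rewrite [in RHS]L_def coefZ -horner_coef0 horner_prod; congr (_ * _).
  by apply: eq_bigr => z _; rewrite !hornerE.
have rs_neq0 z : z \in rs -> z != 0.
  move=> z_in; apply/eqP => z0; move/eqP: L0_prod.
  by rewrite (big_rem _ z_in) /= z0 oppr0 mul0r mulr0 eq_sym oner_eq0.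
exists [seq z^-1 | z <- rs]; last first.
  by rewrite size_map L_def size_scale // size_prod_XsubC.
rewrite big_map [LHS]L_def.
have -> : \prod_(z <- rs) ('X - z%:P) =
    (\prod_(z <- rs) (- z))%:P * \prod_(z <- rs) (1 - z^-1 *: 'X).
  rewrite rmorph_prod -big_split big_seq [RHS]big_seq; apply: eq_bigr => z /rs_neq0 z0.
  rewrite -[RHS]/((- z)%:P * (1 - z^-1 *: 'X)) mulrBr mulr1 mul_polyC scalerA mulNr divff // scaleN1r opprK addrC.
  by rewrite polyCN.
by rewrite -mul_polyC mulrA -polyCM L0_prod mul1r.
Qed.

(* A combination of finitely many consecutive power sums, with the coefficients
   of a polynomial vanishing at all z' in zs other than z, isolates z ^ k. *)
Lemma norm_le_of_power_sums (C : numFieldType) (zs : seq C) (K B : C) :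
  (forall x : C, 0 <= x -> exists k, x < k%:R) ->
  0 < B -> (forall k, (0 < k)%N -> `|\sum_(z <- zs) z ^+ k| <= K * B ^+ k) ->
  forall z, z \in zs -> `|z| <= B.
Proof.
move=> archi B_gt0 sum_le z z_in.
pose Q := \prod_(w <- [seq w <- undup zs | w != z]) ('X - w%:P).
have Qz_neq0 : Q.[z] != 0.
  by rewrite -/(root Q z) root_prod_XsubC mem_filter eqxx.
have Q_eq0 w : w \in zs -> w != z -> Q.[w] = 0.
  by move=> w_in neq_wz; apply/rootP; rewrite root_prod_XsubC mem_filter neq_wz mem_undup.
pose mult : C := (count_mem z zs)%:R.
have mult_gt0 : 0 < mult by rewrite ltr0n -has_count has_pred1.
have isolate k : \sum_(w <- zs) w ^+ k * Q.[w] = mult * (z ^+ k * Q.[z]).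
  rewrite (bigID (pred1 z)) /= [X in _ + X]big1_seq ?addr0; last first.
    by move=> w /andP[neq_wz w_in]; rewrite Q_eq0 ?mulr0.
  rewrite (eq_bigr (fun _ => z ^+ k * Q.[z])) => [|w /eqP-> //].
  by rewrite big_const_seq iter_addr_0 mulr_natl.
pose S := \sum_(i < size Q) `|Q`_i| * B ^+ i.
have pow_le k : (0 < k)%N -> mult * `|Q.[z]| * `|z| ^+ k <= K * S * B ^+ k.
  move=> k_gt0; rewrite -(ger0_norm (ltW mult_gt0)) -normrX -!normrM.
  rewrite [X in `|X|](_ : _ = mult * (z ^+ k * Q.[z])); last by ring.
  rewrite -isolate.
  have -> : \sum_(w <- zs) w ^+ k * Q.[w] =
      \sum_(i < size Q) Q`_i * \sum_(w <- zs) w ^+ (k + i).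
    under [RHS]eq_bigr do rewrite mulr_sumr.
    rewrite exchange_big /=; apply: eq_bigr => w _.
    rewrite horner_coef mulr_sumr; apply: eq_bigr => i _.
    by rewrite exprD mulrCA.
  rewrite (le_trans (ler_norm_sum _ _ _)) // /S mulr_sumr mulr_suml ler_sum // => i _.
  rewrite normrM (le_trans (ler_wpM2l _ (sum_le (k + i)%N _))) ?addn_gt0 ?k_gt0 //.
  by rewrite exprD le_eqVlt; apply/orP; left; apply/eqP; ring.
rewrite real_leNgt ?normr_real ?gtr0_real //; apply/negP => B_lt.
(* If |z| > B, the powers of u > 1 grow at least linearly by Bernoulli's inequality, yet they stay
   below the constant [V]. *)
pose u := `|z| / B; pose delta := u - 1.
have delta_gt0 : 0 < delta by rewrite subr_gt0 ltr_pdivlMr // mul1r.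
have bernoulli k : 1 + k%:R * delta <= u ^+ k.
  elim: k => [|k IHk]; first by rewrite mul0r addr0.
  rewrite exprS; apply: (@le_trans _ _ (u * (1 + k%:R * delta))).
    have -> : u = 1 + delta by rewrite /delta addrCA subrr addr0.
    rewrite -subr_ge0 -[k.+1]addn1 natrD.
    have -> : (1 + delta) * (1 + k%:R * delta) - (1 + (k%:R + 1) * delta) =
        k%:R * delta ^+ 2 by ring.
    by rewrite mulr_ge0 ?ler0n ?exprn_ge0 ?ltW.
  by rewrite ler_wpM2l // divr_ge0 // ltW.
pose V := K * S / (mult * `|Q.[z]|).
have Qz_gt0 : 0 < mult * `|Q.[z]| by rewrite mulr_gt0 // normr_gt0.
have u_le k : (0 < k)%N -> u ^+ k <= V.
  move=> k_gt0; rewrite /V ler_pdivlMr // mulrC expr_div_n mulrA.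
  by rewrite ler_pdivrMr ?exprn_gt0 // pow_le.
have V_ge0 : 0 <= V.
  by rewrite (le_trans _ (u_le 1%N isT)) // expr1 divr_ge0 // ltW.
have [k k_gt] := archi (V / delta) (divr_ge0 V_ge0 (ltW delta_gt0)).
have k_gt0 : (0 < k)%N.
  by rewrite -(ltr0n C) (le_lt_trans _ k_gt) // divr_ge0 // ltW.
have V_lt : V < k%:R * delta by rewrite -ltr_pdivrMr.
have := le_trans (bernoulli k) (u_le k k_gt0).
move=> /le_lt_trans/(_ V_lt); rewrite gtrDr => /lt_trans/(_ ltr01).
by rewrite ltxx.
Qed.

End PowerSums.

(** * Weil's bound *)

(** Distinct monic irreducibles are coprime, so each can be divided out of [G] in turn without
    losing the others. *)
Lemma sum_degree_irr_dvdp_le (F : finFieldType) (s : seq {poly F}) (G : {poly F}) :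
  uniq s -> G != 0 ->
  (forall P, P \in s -> monic_irreducible_poly P /\ P %| G) ->
  (\sum_(P <- s) (size P).-1 <= (size G).-1)%N.
Proof.
elim: s G => [|P s IHs] G; first by rewrite big_nil.
move=> /= /andP[P_notin s_uniq] G_neq0 s_dvd.
have [P_irr P_dvd] := s_dvd P (mem_head _ _).
have [H G_def] : exists H : {poly F}, G = P * H.
  by have [H ->] := dvdpP _ _ P_dvd; exists H; rewrite mulrC.
move: G_neq0; rewrite G_def mulf_eq0 negb_or => /andP[P_neq0 H_neq0].
rewrite big_cons size_mul //.
have /(leq_add (leqnn (size P).-1)) /leq_trans-> // :
    (\sum_(Q <- s) (size Q).-1 <= (size H).-1)%N.
  apply: IHs => // Q Q_in; have Q_in_cons : Q \in P :: s by rewrite inE Q_in orbT.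
  have [Q_irr] := s_dvd Q Q_in_cons; rewrite G_def Gauss_dvdpr //.
  by apply: coprimep_irr => //; apply: contraNneq P_notin => <-.
move: P_neq0 H_neq0; rewrite -!size_poly_gt0.
by case: (size P) => // k _; case: (size H) => // l _; rewrite addnS.
Qed.

(** For the trivial character [coef_L] is q^m, and m q^m is the sum of q^k q^(m-k) over 1 <= k <=
    m. *)
Lemma irr_power_sum_1 (F : finFieldType) (A : comNzRingType) N k :
  (0 < k <= N)%N -> irr_power_sum (fun _ : {poly F} => 1 : A) N k = (#|F| ^ k)%:R.
Proof.
have coef1 m : coef_L (fun _ : {poly F} => 1 : A) m = (#|F| ^ m)%:R.
  by rewrite /coef_L big_const_seq count_predT size_monics iter_addr_0.
move: k; apply: (@power_sums_determined A (fun m => (#|F| ^ m)%:R)) => // m m_le.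
under eq_bigr do rewrite -coef1.
rewrite -coef_L_rec => [|g h _ _|//]; last by rewrite mulr1.
rewrite coef1 -natrM.
rewrite big_nat (eq_bigr (fun _ => (#|F| ^ m)%:R)) => [|k /andP[_ k_le]].
  by rewrite -big_nat big_const_nat iter_addr_0 subn1 natrM mulr_natl.
by rewrite -natrM -expnD subnKC.
Qed.

(** * The L-function of an additive character *)

Section AdditiveCharacter.

Variables (F : finFieldType) (C : numClosedFieldType) (psi : F -> C).
Hypothesis psi_neq0 : forall x, psi x != 0.
Hypothesis psiD : forall x y, psi (x + y) = psi x * psi y.

Lemma additive_char0 : psi 0 = 1.
Proof. by apply: (mulfI (psi_neq0 0)); rewrite -psiD addr0 mulr1. Qed.

Lemma additive_charMn x k : psi (x *+ k) = psi x ^+ k.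
Proof.
by elim: k => [|k IHk]; rewrite ?additive_char0 // mulrS psiD IHk exprS.
Qed.

(** In characteristic p one has psi(x)^p = psi(p x) = 1. *)
Lemma norm_additive_char x : `|psi x| = 1.
Proof.
have [p p_prime p_char] := finPcharP F.
apply/eqP; rewrite -(@pexpr_eq1 _ _ p) ?prime_gt0 // -normrX.
by rewrite -additive_charMn mulrn_pchar // additive_char0 normr1.
Qed.

Hypothesis psi_nontrivial : exists x, psi x != 1.

Lemma sum_additive_char : \sum_x psi x = 0.
Proof.
have [b psi_b] := psi_nontrivial.
have : (psi b - 1) * \sum_x psi x = 0.
  rewrite mulrBl mul1r mulr_sumr [X in _ - X](reindex_inj (addrI b)) /=.
  by apply/eqP; rewrite subr_eq0; apply/eqP/eq_bigr => x _; rewrite psiD.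
by move/eqP; rewrite mulf_eq0 subr_eq0 (negPf psi_b) => /eqP.
Qed.

Variables (f : {poly F}) (n : nat).
Hypothesis f_size : size f = n.+1.
Hypothesis n_gt0 : (0 < n)%N.
Hypothesis n_coprime : coprime n #|F|.

Let chi h := psi (ptrace f h).

Let chiM g h : g \is monic -> h \is monic -> chi (g * h) = chi g * chi h.
Proof. by move=> g_mon h_mon; rewrite /chi ptraceM // psiD. Qed.

Let coef_L0 : coef_L chi 0 = 1.
Proof. by rewrite /coef_L monics0 big_seq1 /chi ptrace1 additive_char0. Qed.

Lemma natf_coprime_card_neq0 : n%:R != 0 :> F.
Proof.
have q_gt1 := finNzRing_gt1 F.
have r_char : pdiv #|F| \in [pchar F].
  have := pnat_pchar_card_expn (idfun : {rmorphism F -> F}) 1.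
  by rewrite expn1 => /pnatPpi; apply; rewrite pi_pdiv.
rewrite -(dvdn_pcharf r_char); apply/negP => r_dvd.
have := dvdn_gcd (pdiv #|F|) n #|F|; rewrite r_dvd pdiv_dvd (eqP n_coprime) dvdn1.
by move/eqP=> r1; have := pdiv_prime q_gt1; rewrite r1.
Qed.

Lemma coef_L_char_eq0 m : (n <= m)%N -> coef_L chi m = 0.
Proof.
move=> n_le; have [b psi_b] := psi_nontrivial.
have lc_neq0 : lead_coef f != 0 by rewrite lead_coef_eq0 -size_poly_gt0 f_size.
(* Chosen so that - a n [lead_coef f] = b: by [ptrace_shift] the shift then multiplies [chi] by
   [psi b], which is not 1. *)
pose a := - b / (n%:R * lead_coef f).
have shift (h : {poly F}) : h \in monics F m -> chi (h + a *: 'X^(m - n)) = psi b * chi h.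
  rewrite mem_monics => /andP[h_mon /eqP h_size].
  rewrite /chi (ptrace_shift _ f_size _ h_mon h_size) ?n_gt0 // -mulrA divfK.
    by rewrite opprK addrC psiD.
  by rewrite mulf_neq0 ?natf_coprime_card_neq0.
have perm_shift : perm_eq [seq h + a *: 'X^(m - n) | h <- monics F m] (monics F m).
  apply: uniq_perm => [||h]; last 1 first.
  - have Xmn_size c : (size (c *: 'X^(m - n) : {poly F}) < m.+1)%N.
      by rewrite (leq_ltn_trans (size_scale_leq _ _)) // size_polyXn; lia.
    have monics_shift c (g : {poly F}) : g \in monics F m -> g + c *: 'X^(m - n) \in monics F m.
      rewrite !mem_monics => /andP[g_mon /eqP g_size].
      have lt_size : (size (c *: 'X^(m - n) : {poly F}) < size g)%N.
        by rewrite g_size.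
      by rewrite monicE lead_coefDl // -monicE g_mon size_polyDl // g_size eqxx.
    apply/mapP/idP => [[g g_in ->]|h_in]; first exact: monics_shift.
    exists (h + (- a) *: 'X^(m - n)); first exact: monics_shift.
    by rewrite scaleNr subrK.
  - by rewrite map_inj_uniq ?uniq_monics //; apply: addIr.
  - exact: uniq_monics.
have : (psi b - 1) * coef_L chi m = 0.
  rewrite mulrBl mul1r; apply/eqP; rewrite subr_eq0; apply/eqP.
  rewrite /coef_L mulr_sumr -[RHS](perm_big _ perm_shift) [RHS]big_map.
  by rewrite big_seq [RHS]big_seq; apply: eq_bigr => h /shift.
by move/eqP; rewrite mulf_eq0 subr_eq0 (negPf psi_b) => /eqP.
Qed.

(** For k > 0 this is the number of x in the extension of degree k of [F] such that f(x) has trace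
    c, each [P] standing for its deg P roots. *)
Let count_trace k c : nat :=
  \sum_(P <- irrs F k)
    \sum_(1 <= j < k.+1 | ((j * (size P).-1)%N == k) && (ptrace f (P ^+ j) == c))
      (size P).-1.

Let count_trace_le t c : (0 < t)%N ->
  (count_trace t.*2 c <= #|F| ^ t.*2.-1 + 2 * n * #|F| ^ t)%N.
Proof.
move=> t_gt0.
have [G [G_neq0 G_size G_dvd]] := stepanov_polynomial f_size n_gt0 n_coprime t_gt0 c.
apply: (@leq_trans (size G).-1); last first.
  by rewrite -ltnS prednK // size_poly_gt0.
apply: (@leq_trans (\sum_(P <- [seq P <- irrs F t.*2 | P %| G]) (size P).-1)); last first.
  apply: sum_degree_irr_dvdp_le => // [|P]; first exact/filter_uniq/uniq_irrs.
  by rewrite mem_filter => /andP[P_dvd /mem_irrs[]].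
rewrite big_filter [X in (_ <= X)%N]big_mkcond /count_trace.
rewrite big_seq [X in (_ <= X)%N]big_seq; apply: leq_sum => P /mem_irrs[P_irr _].
have P_gt0 : (0 < (size P).-1)%N by rewrite ltn_predRL; case: P_irr => -[].
have [P_dvd|P_ndvd] := boolP (P %| G); last first.
  rewrite big1 // => j /andP[/eqP jP /eqP P_trace].
  by rewrite (G_dvd P j) in P_ndvd.
rewrite big_mkcond /=.
(* Each [P] is counted at most once, since j deg P = 2t determines j. *)
have [/hasP[j j_in /andP[/eqP jP _]]|no_j] :=
    boolP (has (fun j => ((j * (size P).-1)%N == t.*2) &&
                         (ptrace f (P ^+ j) == c)) (index_iota 1 t.*2.+1)).
  rewrite (bigD1_seq j) ?iota_uniq //= [X in (_ + X)%N]big1 ?addn0.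
    by case: ifP.
  move=> i; case: ifP => // /andP[/eqP iP _]; apply: contraNeq => _.
  by rewrite -(eqn_pmul2r P_gt0) iP jP.
rewrite big1_seq // => j /andP[_ j_in]; case: ifP => // j_ok.
by case/hasP: no_j; exists j.
Qed.

Let irr_power_sum_count k (phi : F -> C) :
  irr_power_sum (fun h => phi (ptrace f h)) k k = \sum_c phi c * (count_trace k c)%:R.
Proof.
rewrite /irr_power_sum /count_trace.
under [RHS]eq_bigr do rewrite natr_sum mulr_sumr.
rewrite [RHS]exchange_big; apply: eq_bigr => P _ /=.
under [RHS]eq_bigr do rewrite natr_sum mulr_sumr big_mkcondr /=.
rewrite [RHS]exchange_big; apply: eq_bigr => j _ /=.
rewrite (bigD1 (ptrace f (P ^+ j))) //= eqxx big1 ?addr0 1?mulrC // => c.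
by rewrite eq_sym => /negPf->.
Qed.

Lemma irr_power_sum_char_le t : (0 < t)%N ->
  `|irr_power_sum chi t.*2 t.*2| <= (#|F| * (2 * n))%:R * #|F|%:R ^+ t.
Proof.
move=> t_gt0; pose U : C := (#|F| ^ t.*2.-1 + 2 * n * #|F| ^ t)%:R.
have total : \sum_c (count_trace t.*2 c)%:R = (#|F| ^ t.*2)%:R :> C.
  have := irr_power_sum_1 F C (_ : 0 < t.*2 <= t.*2)%N => <-; last first.
    by rewrite leqnn double_gt0 t_gt0.
  rewrite (irr_power_sum_count t.*2 (fun _ => 1)).
  by apply: eq_bigr => c _; rewrite mul1r.
rewrite irr_power_sum_count.
(* Stepanov's method bounds each count only from above by [U]. As the values of [psi] sum to 0, the
   counts may be replaced by the defects U - count >= 0, whose total q U - q^(2t) is small. *)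
have -> : \sum_c psi c * (count_trace t.*2 c)%:R =
    - \sum_c psi c * (U - (count_trace t.*2 c)%:R).
  under [in RHS]eq_bigr do rewrite mulrBr.
  by rewrite sumrB -mulr_suml sum_additive_char mul0r sub0r opprK.
rewrite normrN (le_trans (ler_norm_sum _ _ _)) //.
apply: (@le_trans _ _ (\sum_c (U - (count_trace t.*2 c)%:R))).
  apply: ler_sum => c _; rewrite normrM norm_additive_char mul1r ger0_norm //.
  by rewrite subr_ge0 ler_nat count_trace_le.
rewrite sumrB total sumr_const /U -mulrnA mulnC -natrX -natrM.
have q_ge1 : (0 < #|F|)%N by apply: ltnW; apply: finNzRing_gt1.
have -> : (#|F| ^ t.*2 = #|F| * #|F| ^ t.*2.-1)%N.
  by rewrite -expnS prednK // double_gt0.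
by rewrite mulnDr natrD addrAC subrr add0r mulnA.
Qed.

(* The series sum_m (coef_L chi m) T^m is a polynomial of degree at most n - 1;
   the k-th power sum of its inverse roots is - irr_power_sum chi k k. *)
Lemma weil_bound :
  (forall x : C, 0 <= x -> exists k, x < k%:R) ->
  `|\sum_x psi f.[x]| <= n.-1%:R * sqrtC #|F|%:R.
Proof.
move=> archi; pose L := \poly_(m < n) coef_L chi m.
have L_coef m : L`_m = coef_L chi m.
  by rewrite coef_poly; case: ltnP => // /coef_L_char_eq0.
have [ws L_def ws_size] : exists2 ws : seq C,
    L = \prod_(w <- ws) (1 - w *: 'X) & size ws = (size L).-1.
  by apply: prod_1subX_factor; rewrite L_coef coef_L0.
have power_sumE N k : (0 < k <= N)%N ->
    irr_power_sum chi N k = - \sum_(w <- ws) w ^+ k.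
  move: k; apply: (@power_sums_determined C (coef_L chi)) => // m m_le.
  rewrite -coef_L_rec // -L_coef L_def newton_prod -sumrN; apply: eq_bigr => k _.
  by rewrite mulNr -L_def L_coef.
(* Only power sums of even index have been bounded, so the w^2 are estimated, with q in place of its
   square root. *)
have ws_le w : w \in ws -> `|w| <= sqrtC #|F|%:R.
  move=> w_in; rewrite -(@ler_pXn2r _ 2) ?nnegrE ?sqrtC_ge0 ?ler0n //.
  rewrite sqrtCK -normrX.
  apply: (@norm_le_of_power_sums _ [seq v ^+ 2 | v <- ws] (#|F| * (2 * n))%:R) => //.
  - by rewrite ltr0n ltnW // finNzRing_gt1.
  - move=> t t_gt0; rewrite big_map -normrN.
    under eq_bigr do rewrite -exprM mul2n.
    by rewrite -(power_sumE t.*2) ?irr_power_sum_char_le // double_gt0 t_gt0 leqnn.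
  - exact: map_f.
have -> : \sum_x psi f.[x] = coef_L chi 1.
  rewrite /coef_L (perm_big _ (monics1 F)) big_image.
  by apply: eq_bigr => x _; rewrite /chi ptrace_XsubC.
have -> : coef_L chi 1 = - \sum_(w <- ws) w.
  have := coef_L_rec chiM (leqnn 1).
  by rewrite mul1r big_nat1 subnn coef_L0 mulr1 power_sumE.
rewrite normrN (le_trans (ler_norm_sum _ _ _)) //.
rewrite big_seq (le_trans (ler_sum _ ws_le)) // -big_seq big_const_seq count_predT.
rewrite iter_addr_0 -[X in X <= _]mulr_natl ler_wpM2r ?sqrtC_ge0 ?ler0n // ler_nat.
by rewrite ws_size -!subn1 leq_sub2r // size_poly.
Qed.

End AdditiveCharacter.

(** * Sums over cyclotomic cosets *)

Lemma sum_nat_euclid (A : nmodType) (phi : nat -> A) a b :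
  \sum_(0 <= s < a * b) phi s = \sum_(0 <= t < b) \sum_(0 <= i < a) phi (i + a * t)%N.
Proof.
elim: b => [|b IHb]; first by rewrite muln0 !big_geq.
rewrite mulnS addnC (big_cat_nat _ (n := (a * b)%N)) ?leq_addr //= IHb big_nat_recr //=.
congr (_ + _); rewrite -[X in \sum_(X <= i < _) _]add0n big_addn.
by rewrite [(a * b + a)%N]addnC addnK.
Qed.

Section NonzeroSums.

Variables (F : finFieldType) (gamma : F).
Hypothesis gamma_prim : (#|F| - 1)%N.-primitive_root gamma.

Let gamma_neq0 : gamma != 0.
Proof.
apply/eqP => gamma0; have := prim_expr_order gamma_prim.
by rewrite gamma0 expr0n gtn_eqF ?(prim_order_gt0 gamma_prim) // => /eqP;
  rewrite eq_sym oner_eq0.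
Qed.

Lemma sum_nonzero_primitive (A : nmodType) (phi : F -> A) :
  \sum_(x | x != 0) phi x = \sum_(0 <= t < #|F| - 1) phi (gamma ^+ t).
Proof.
rewrite -(big_map (fun t => gamma ^+ t) xpredT phi) -big_enum /=.
apply: perm_big; rewrite perm_sym.
have powers_uniq : uniq [seq gamma ^+ t | t <- index_iota 0 (#|F| - 1)].
  rewrite map_inj_in_uniq ?iota_uniq // => s t.
  rewrite !mem_index_iota => /andP[_ s_lt] /andP[_ t_lt] /eqP.
  by rewrite (eq_prim_root_expr gamma_prim) !modn_small // => /eqP.
apply: uniq_perm; rewrite ?enum_uniq //.
apply: (uniq_min_size powers_uniq _ _).2 => [x /mapP[t _ ->]|].
  by rewrite mem_enum unfold_in expf_neq0.
by rewrite size_map size_iota -cardE cardC1 subn0 subn1.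
Qed.

(** With y = gamma^t the argument is gamma^(i + d t), and the exponents i + d t run once through the
    integers below d (q - 1), hence d times through a period of gamma. *)
Lemma sum_cyclotomic_cosets (A : nmodType) (phi : F -> A) d :
  \sum_(i < d) \sum_(y | y != 0) phi (gamma ^+ i * y ^+ d) =
  (\sum_(x | x != 0) phi x) *+ d.
Proof.
rewrite sum_nonzero_primitive.
under eq_bigr => i _.
  rewrite (sum_nonzero_primitive (fun y => phi (gamma ^+ i * y ^+ d))).
  under eq_bigr => t _ do rewrite -exprM -exprD mulnC.
  over.
rewrite exchange_big /=.
under eq_bigr do rewrite -(big_mkord xpredT (fun i => phi (gamma ^+ (i + d * _)))).
rewrite -(sum_nat_euclid (fun s => phi (gamma ^+ s))) mulnC sum_nat_euclid.
rewrite (eq_bigr (fun _ => \sum_(0 <= t < #|F| - 1) phi (gamma ^+ t))).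
  by rewrite big_const_nat subn0 iter_addr_0.
move=> u _; apply: eq_bigr => t _.
by rewrite exprD exprM (prim_expr_order gamma_prim) expr1n mulr1.
Qed.

End NonzeroSums.

(** Sum phi(y^N z^e) over all nonzero y and z in two ways: by Bezout z^e = (z^u)^N is absorbed into
    y, and y^N = (y^(N/e))^e is absorbed into z. *)
Lemma sum_expr_gcdn (F : finFieldType) (C : numDomainType) (phi : F -> C) N :
  (0 < N)%N -> \sum_y phi (y ^+ N) = \sum_y phi (y ^+ gcdn N (#|F| - 1)).
Proof.
move=> N_gt0; set e := gcdn _ _.
have e_gt0 : (0 < e)%N by rewrite gcdn_gt0 N_gt0.
have q1_gt0 : (0 < #|F| - 1)%N by rewrite subn_gt0 finNzRing_gt1.
have expr_q1 (z : F) : z != 0 -> z ^+ (#|F| - 1) = 1.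
  move=> z_neq0; apply: (mulfI z_neq0).
  by rewrite -exprS subn1 prednK ?expf_card ?mulr1 // ltnW // finNzRing_gt1.
have scale k (z : F) : z != 0 ->
    \sum_(y | y != 0) phi (y ^+ k) = \sum_(y | y != 0) phi ((y * z) ^+ k).
  move=> z_neq0; rewrite (reindex_inj (mulIf z_neq0)) /=; apply: eq_bigl => y.
  by rewrite mulf_eq0 (negPf z_neq0) orbF.
have [u v bezout _] := egcdnP (#|F| - 1) N_gt0; rewrite -/e in bezout.
have N_mean : \sum_(z | z != 0) \sum_(y : F | y != 0) phi (y ^+ N * z ^+ e) =
    (\sum_(y | y != 0) phi (y ^+ N)) *+ (#|F| - 1).
  rewrite subn1 -(cardC1 (0 : F)) -sumr_const; apply: eq_bigr => z z_neq0.
  rewrite (scale N (z ^+ u)) ?expf_neq0 //; apply: eq_bigr => y _.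
  by rewrite exprMn -exprM bezout exprD mulnC exprM expr_q1 // expr1n mul1r.
have e_mean : \sum_(z | z != 0) \sum_(y : F | y != 0) phi (y ^+ N * z ^+ e) =
    (\sum_(y | y != 0) phi (y ^+ e)) *+ (#|F| - 1).
  rewrite exchange_big /= subn1 -(cardC1 (0 : F)) -sumr_const.
  apply: eq_bigr => y y_neq0.
  rewrite (scale e (y ^+ (N %/ e))) ?expf_neq0 //; apply: eq_bigr => z _.
  by rewrite exprMn -exprM divnK ?dvdn_gcdl // mulrC.
rewrite (bigD1 0) //= [RHS](bigD1 0) //= !expr0n !gtn_eqF //; congr (_ + _).
have q1_neq0 : (#|F| - 1)%:R != 0 :> C by rewrite pnatr_eq0 -lt0n.
by apply: (mulIf q1_neq0); rewrite !mulr_natr -N_mean -e_mean.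
Qed.

Lemma complex_archimedean (R : realType) (x : R[i]) : 0 <= x -> exists k, x < k%:R.
Proof.
case: x => a b; rewrite lecE /= => /andP[/eqP-> a_ge0].
exists (Num.bound a); rewrite ltcE !raddfMn /= mul0rn eqxx /=.
exact: archi_boundP.
Qed.

Section CyclotomicSum.

Variables (F : finFieldType) (C : numClosedFieldType) (psi : F -> C).
Hypothesis psi_neq0 : forall x, psi x != 0.
Hypothesis psiD : forall x y, psi (x + y) = psi x * psi y.
Variables (d : nat) (gamma : F) (g : {poly F}) (h : 'I_d -> {poly F}).
Hypothesis d_gt0 : (0 < d)%N.
Hypothesis gamma_prim : (#|F| - 1)%N.-primitive_root gamma.
Hypothesis g_at0 : g.[0] = 0.
Hypothesis h_at0 : forall i, (h i).[0] = 0.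
Hypothesis h_def : forall (i : 'I_d) y, y != 0 -> g.[gamma ^+ i * y ^+ d] = (h i).[y].

(** Each nonzero x arises d times as gamma^i y^d, and the term x = 0, taken d times, supplies the
    term y = 0 for each i. *)
Lemma cyclotomic_sum : d%:R * \sum_x psi g.[x] = \sum_i \sum_y psi (h i).[y].
Proof.
rewrite (bigD1 0) //= g_at0 (additive_char0 psi_neq0 psiD) mulrDr mulr1.
rewrite [_ * \sum_(_ | _) _]mulr_natl.
rewrite -(sum_cyclotomic_cosets gamma_prim (fun x => psi g.[x])).
rewrite -[X in X%:R + _]card_ord -sumr_const -big_split; apply: eq_bigr => i _ /=.
rewrite [RHS](bigD1 0) //= h_at0 (additive_char0 psi_neq0 psiD); congr (_ + _).
by apply: eq_bigr => y /h_def->.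
Qed.

Variables (L : {set 'I_d}) (M : 'I_d -> nat).
Hypothesis h_eq0 : forall i, i \notin L -> h i = 0.
Hypothesis h_le : forall i, i \in L ->
  `|\sum_y psi (h i).[y]| <= (d * M i)%:R * sqrtC #|F|%:R.

(** An index outside [L] contributes exactly q, which gives the main term after division by d; the
    same division cancels the factor d in [h_le]. *)
Lemma cyclotomic_sum_le :
  `|\sum_x psi g.[x] - #|F|%:R / d%:R * (d - #|L|)%:R| <=
  (d%:R - (d - #|L|)%:R) * (\max_(i in L) M i)%:R * sqrtC #|F|%:R.
Proof.
have d_pos : 0 < d%:R :> C by rewrite ltr0n.
have L_le : (#|L| <= d)%N by rewrite -[X in (_ <= X)%N]card_ord max_card.
have -> : d%:R - (d - #|L|)%:R = #|L|%:R :> C by rewrite natrB // opprB addrC subrK.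
have rest : \sum_(i | i \notin L) \sum_y psi (h i).[y] = (#|F| * (d - #|L|))%:R.
  rewrite (eq_bigr (fun _ => #|F|%:R)) => [|i /h_eq0 ->]; last first.
    under eq_bigr do rewrite horner0 (additive_char0 psi_neq0 psiD).
    by rewrite sumr_const.
  rewrite sumr_const -mulrnA; congr (_ * _)%:R.
  by have := cardC (mem L); rewrite card_ord => /(canRL (addKn _)) <-; apply: eq_card.
have -> : \sum_x psi g.[x] - #|F|%:R / d%:R * (d - #|L|)%:R =
    (\sum_(i in L) \sum_y psi (h i).[y]) / d%:R.
  apply: (mulfI (lt0r_neq0 d_pos)).
  rewrite mulrBr cyclotomic_sum (bigID (mem L)) /= rest natrM.
  by field; rewrite lt0r_neq0.
rewrite normrM normfV (ger0_norm (ltW d_pos)) ler_pdivrMr //.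
rewrite (le_trans (ler_norm_sum _ _ _)) //.
apply: (@le_trans _ _
    (\sum_(i in L) (\max_(i in L) M i)%:R * sqrtC #|F|%:R * d%:R)).
  apply: ler_sum => i i_in; rewrite (le_trans (h_le i_in)) // natrM -mulrA mulrC.
  rewrite ler_wpM2r ?ler0n // ler_wpM2r ?sqrtC_ge0 ?ler0n // ler_nat.
  exact: leq_bigmax_cond.
by rewrite sumr_const -[X in X <= _]mulr_natl !mulrA.
Qed.

End CyclotomicSum.

(** * Reduction of the cyclotomic sum to Weil's bound *)

Theorem theorem1p2 (R : realType)
    (p m q : nat) (p_prime : prime p) (q_def : q = (p ^ m)%N)
    (F : finFieldType) (card_F : #|F| = q)
    (d : nat) (d_dvd : (d %| q - 1)%N)
    (gamma : F) (gamma_prim : (q - 1)%N.-primitive_root gamma)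
    (a : 'I_d -> F) (Rp : 'I_d -> {poly F}) (r : 'I_d -> nat)
    (Rp_neq0 : forall i, Rp i != 0)
    (Rp_at0 : forall i, (Rp i).[0] = 0)
    (r_deg : forall i, r i = (size (Rp i)).-1)
    (g : {poly F}) (g_at0 : g.[0] = 0)
    (g_coset : forall (i : 'I_d) (x : F),
       x \in cyclotomic_coset d gamma i -> g.[x] = a i * (Rp i).[x])
    (L : {set 'I_d}) (L_def : L = [set i | a i != 0])
    (n0 : nat) (n0_def : n0 = (d - #|L|)%N)
    (r_coprime : forall i, i \in L -> gcdn (r i) p = 1%N)
    (psi : F -> R[i]) (psi_char : additive_character psi)
    (psi_nontriv : nontrivial_character psi) :
  `| \sum_(x : F) psi g.[x] - q%:R / d%:R * n0%:R |
    <= (d%:R - n0%:R) * (\max_(i in L) r i)%:R * sqrtC (q%:R : R[i])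
  /\
  ((forall i, Rp i = 'X^(r i)) ->
   `| \sum_(x : F) psi g.[x] - q%:R / d%:R * n0%:R |
     <= (d%:R - n0%:R) * (\max_(i in L) gcdn (r i) ((q - 1) %/ d))%:R
        * sqrtC (q%:R : R[i])).

Proof.
have [psi_neq0 psiD] := psi_char.
subst q n0; rewrite -card_F in d_dvd gamma_prim *.
have q_gt1 := finNzRing_gt1 F.
have q1_gt0 : (0 < #|F| - 1)%N by rewrite subn_gt0.
have d_gt0 : (0 < d)%N by apply: dvdn_gt0 d_dvd.
have coprime_q1 k : (k %| #|F| - 1)%N -> coprime k #|F|.
  move=> k_dvd; apply: coprime_dvdl k_dvd _.
  by rewrite subn1 coprime_sym -{1}(prednK (ltnW q_gt1)) coprimeSn.
have gamma_neq0 : gamma != 0.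
  apply/eqP => gamma0; have := prim_expr_order gamma_prim.
  by rewrite gamma0 expr0n gtn_eqF // => /eqP; rewrite eq_sym oner_eq0.
have a_neq0 i : (i \in L) = (a i != 0) by rewrite L_def inE.
pose h i := a i *: (Rp i \Po (gamma ^+ i *: 'X^d)).
have h_horner i y : (h i).[y] = a i * (Rp i).[gamma ^+ i * y ^+ d].
  by rewrite hornerZ horner_comp hornerZ hornerXn.
have h_at0 i : (h i).[0] = 0.
  by rewrite h_horner expr0n gtn_eqF // mulr0 Rp_at0 mulr0.
have h_def (i : 'I_d) y : y != 0 -> g.[gamma ^+ i * y ^+ d] = (h i).[y].
  move=> y_neq0; rewrite h_horner -g_coset //; apply/imsetP; exists (y ^+ d) => //.
  by rewrite inE expf_neq0 //; apply/existsP; exists y.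
have h_eq0 i : i \notin L -> h i = 0.
  by rewrite a_neq0 negbK /h => /eqP->; rewrite scale0r.
(* A nonzero polynomial vanishing at 0 is not constant. *)
have r_gt0 i : (0 < r i)%N.
  rewrite r_deg ltn_predRL ltnNge; apply: contra (Rp_neq0 i) => /size1_polyC R_const.
  by have := Rp_at0 i; rewrite R_const hornerC => ->; rewrite polyC0.
have weil := weil_bound psi_neq0 psiD psi_nontriv.
split=> [|Rp_monomial].
- apply: (cyclotomic_sum_le psi_neq0 psiD d_gt0 gamma_prim g_at0 h_at0 h_def h_eq0).
  move=> i i_in; have h_size : size (h i) = (d * r i).+1.
    have arg_size : size (gamma ^+ i *: 'X^d : {poly F}) = d.+1.
      by rewrite size_scale ?expf_neq0 // size_polyXn.
    have comp_gt0 : (0 < size (Rp i \Po (gamma ^+ i *: 'X^d)))%N.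
      by rewrite size_poly_gt0 comp_poly_eq0 ?arg_size.
    rewrite size_scale -?a_neq0 // -(prednK comp_gt0) size_comp_poly arg_size.
    by rewrite r_deg mulnC.
  have h_coprime : coprime (d * r i) #|F|.
    rewrite coprimeMl coprime_q1 //= card_F coprimeXr //.
    by rewrite /coprime r_coprime.
  rewrite (le_trans (weil _ _ h_size _ h_coprime _)) ?muln_gt0 ?d_gt0 ?r_gt0 //.
    exact: complex_archimedean.
  (* Weil's bound has the factor d r_i - 1, which is relaxed to d r_i. *)
  by rewrite ler_wpM2r ?sqrtC_ge0 ?ler0n // ler_nat leq_pred.
- apply: (cyclotomic_sum_le psi_neq0 psiD d_gt0 gamma_prim g_at0 h_at0 h_def h_eq0).
  move=> i i_in; pose e := gcdn (d * r i) (#|F| - 1).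
  (* This e divides q - 1, hence is prime to q, so Weil's bound applies to a monomial of degree
     e. *)
  have e_def : (d * gcdn (r i) ((#|F| - 1) %/ d) = e)%N.
    by rewrite /e -{2}(divnK d_dvd) [(_ %/ d * d)%N]mulnC -muln_gcdr.
  (* Here a_i R_i(gamma^i y^d) = b y^(d r_i), and the exponent d r_i may be replaced by its gcd e
     with q - 1. *)
  pose b := a i * gamma ^+ (i * r i); pose f : {poly F} := b *: 'X^e.
  have b_neq0 : b != 0 by rewrite mulf_neq0 ?expf_neq0 -?a_neq0.
  have e_gt0 : (0 < e)%N by rewrite gcdn_gt0 q1_gt0 orbT.
  have -> : \sum_y psi (h i).[y] = \sum_y psi f.[y].
    under eq_bigr => y _.
      rewrite h_horner Rp_monomial hornerXn exprMn -!exprM mulrA -/b.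
      over.
    rewrite (sum_expr_gcdn (fun y => psi (b * y))) ?muln_gt0 ?d_gt0 ?r_gt0 //.
    by apply: eq_bigr => y _; rewrite hornerZ hornerXn.
  have f_size : size f = e.+1 by rewrite size_scale // size_polyXn.
  rewrite e_def (le_trans (weil _ _ f_size e_gt0 _ _)) ?coprime_q1 ?dvdn_gcdr //.
    exact: complex_archimedean.
  by rewrite ler_wpM2r ?sqrtC_ge0 ?ler0n // ler_nat leq_pred.
Qed.
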